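(* Let $n\ge 2$ and let $\rho$ be a finite-dimensional complex representation of the dihedral group $W(\mathrm{I}_2(n))$ of order $2n$. Say that $\rho$ has an irreducible representation if the latter occurs with positive multiplicity in the decomposition of $\rho$ into irreducible representations. Then $\rho$ is faithful if and only if the following condition holds. (i) When $n=2$: $\rho$ has at least two of $\rho_{1,2}^{2},\rho_{1,3}^{2},\rho_{1,4}^{2}$. (ii) When $n>2$ and $2\nmid n$: $\rho$ has distinct two-dimensional irreducible representations $\rho_{2,k_1}^{n},\dots,\rho_{2,k_t}^{n}$ ($t\ge 1$) with $\gcd\big((n,k_1),\dots,(n,k_t)\big)=1$. (iii) When $n>2$ and $2\mid n$: either $\rho$ has neither $\rho_{1,3}^{n}$ nor $\rho_{1,4}^{n}$, and $\rho$ has two-dimensional irreducible representations $\rho_{2,k_1}^{n},\dots,\rho_{2,k_t}^{n}$ ($t\ge 1$) with $\gcd\big((n,k_1),\dots,(n,k_t)\big)=1$; or $\rho$ has at least one of $\rho_{1,3}^{n},\rho_{1,4}^{n}$, and $\rho$ has two-dimensional irreducible representations $\rho_{2,k_1}^{n},\dots,\rho_{2,k_t}^{n}$ ($t\ge 1$) with $\gcd\big(\tfrac n2,(n,k_1),\dots,(n,k_t)\big)=1$.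
   Context: $W(\mathrm{I}_2(n))=\langle s_1,s_2\mid s_1^2=s_2^2=(s_1s_2)^n=1\rangle$ is the dihedral group of order $2n$, and $(a,b)$ denotes the greatest common divisor. All representations are finite-dimensional over $\mathbb{C}$. The irreducible representations of $W(\mathrm{I}_2(n))$ are denoted as follows. One-dimensional: $\rho_{1,1}^n(s_1)=\rho_{1,1}^n(s_2)=1$; $\rho_{1,2}^n(s_1)=\rho_{1,2}^n(s_2)=-1$; and, only when $n$ is even, $\rho_{1,3}^n(s_1)=1,\ \rho_{1,3}^n(s_2)=-1$ and $\rho_{1,4}^n(s_1)=-1,\ \rho_{1,4}^n(s_2)=1$. Two-dimensional: for integers $k$ with $1\le k\le \frac{n-1}{2}$ ($n$ odd) or $1\le k\le\frac{n-2}{2}$ ($n$ even), $$\rho_{2,k}^n(s_1)=\begin{pmatrix}0&1\\1&0\end{pmatrix},\qquad \rho_{2,k}^n(s_2)=\begin{pmatrix}0&e^{2\pi i k/n}\\ e^{-2\pi i k/n}&0\end{pmatrix}.$$ *)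

(* Defs.v *)
From mathcomp Require Import all_boot all_order all_algebra all_fingroup.
From mathcomp Require Import mxrepresentation.
From mathcomp Require Import complex.
From mathcomp Require Import reals trigo.

Set Implicit Arguments.
Unset Strict Implicit.
Unset Printing Implicit Defensive.

Import GRing.Theory.
Local Open Scope ring_scope.
Local Open Scope complex_scope.

(* G is the dihedral group W(I_2(n)), with s1 and s2 as its Coxeter           *)
(* generators. The Grp notation hides the generators, so we also require that *)
(* s1 and s2 generate G and satisfy the relations; as G is finite, the        *)
(* surjective map from the presented group onto G sending its generators to   *)
(* s1 and s2 is then an isomorphism.                                          *)
Definition is_WI2 (gT : finGroupType) (G : {group gT}) (s1 s2 : gT) (n : nat) :
    Prop :=
  [/\ (G \isog Grp (x : y : x ^+ 2, y ^+ 2, (x * y) ^+ n))%g,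
      G :=: <<[set s1; s2]>>%g,
      (s1 ^+ 2 = 1)%g, (s2 ^+ 2 = 1)%g & ((s1 * s2) ^+ n = 1)%g].

(* rho has a decomposition into irreducible representations one of whose      *)
(* summands is isomorphic to sigma. Multiplicities do not depend on the       *)
(* decomposition, so this says that sigma has positive multiplicity in rho.   *)
Definition occurs_in (F : fieldType) (gT : finGroupType) (G : {group gT})
    (m d : nat) (sigma : mx_representation F G m)
    (rho : mx_representation F G d) : Prop :=
  exists (t : nat) (U : 'I_t -> 'M[F]_d) (simU : forall i, mxsimple rho (U i)),
    [/\ (\sum_i U i :=: 1%:M)%MS, mxdirect (\sum_i U i)%MS &
        exists i, mx_rsim (submod_repr (mxsimple_module (simU i))) sigma].

(* As s1 and s2 generate G, the representation sigma is determined on G by    *)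
(* the two matrices A1 and A2.                                                *)
Definition has_irr (F : fieldType) (gT : finGroupType) (G : {group gT})
    (s1 s2 : gT) (d : nat) (rho : mx_representation F G d)
    (m : nat) (A1 A2 : 'M[F]_m) : Prop :=
  exists sigma : mx_representation F G m,
    [/\ sigma s1 = A1, sigma s2 = A2 & occurs_in sigma rho].

Definition expi (R : realType) (x : R) : R[i] := cos x +i* sin x.

Definition antidiag2 (F : fieldType) (a b : F) : 'M[F]_2 :=
  \matrix_(i, j) (if i == j then 0 else if i == 0 then a else b).

Section Dihedral.

Variables (R : realType) (gT : finGroupType) (G : {group gT}) (s1 s2 : gT).
Variables (n d : nat) (rho : mx_representation R[i] G d).

Local Notation sgn1 := (1%:M : 'M[R[i]]_1).
Local Notation sgnN1 := ((-1)%:M : 'M[R[i]]_1).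

Definition has_rho12 : Prop := has_irr s1 s2 rho sgnN1 sgnN1.
Definition has_rho13 : Prop := has_irr s1 s2 rho sgn1 sgnN1.
Definition has_rho14 : Prop := has_irr s1 s2 rho sgnN1 sgn1.

Definition rho2_range (k : nat) : bool :=
  (1 <= k <= if odd n then (n - 1)./2 else (n - 2)./2)%N.

Definition has_rho2 (k : nat) : Prop :=
  let theta : R := 2 * pi * k%:R / n%:R in
  has_irr s1 s2 rho (antidiag2 1 1) (antidiag2 (expi theta) (expi (- theta))).

Definition has_rho2s (ks : seq nat) : Prop :=
  (1 <= size ks)%N /\ forall k, k \in ks -> rho2_range k /\ has_rho2 k.

Definition gcd_gcds (ks : seq nat) : nat := \big[gcdn/0%N]_(k <- ks) gcdn n k.

Definition faithful_cond_2 : Prop :=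
  [\/ has_rho12 /\ has_rho13, has_rho12 /\ has_rho14 | has_rho13 /\ has_rho14].

Definition faithful_cond_odd : Prop :=
  exists ks : seq nat, [/\ uniq ks, has_rho2s ks & gcd_gcds ks = 1%N].

Definition faithful_cond_even : Prop :=
  [/\ ~ has_rho13, ~ has_rho14 &
      exists ks : seq nat, has_rho2s ks /\ gcd_gcds ks = 1%N]
  \/ (has_rho13 \/ has_rho14) /\
     (exists ks : seq nat,
        has_rho2s ks /\ gcdn (n %/ 2) (gcd_gcds ks) = 1%N).

End Dihedral.

(* Main.v *)
Require Import Defs.
From mathcomp Require Import all_boot all_order all_algebra all_fingroup.
From mathcomp Require Import mxrepresentation complex reals.
From mathcomp Require Import boolp trigo cyclic pgroup extremal spectral.
From mathcomp Require Import zify lra.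

(** By complete reducibility, the kernel of [rho] is the intersection of the
    kernels of the irreducible representations that occur in it
    ([mem_rker_constituents]).  So faithfulness depends only on which
    irreducibles occur, and the theorem follows from knowing the irreducible
    representations of the dihedral group and the kernel of each.

    Classification ([irr_WI2]).  Write [r = s1 s2].  An eigenvector [v] of [r]
    and its image under [s1] span a submodule: [r s1 = s1 r^-1], so that image
    is an eigenvector of [r] for the inverse eigenvalue.  An irreducible
    representation therefore has degree at most 2.  In degree 1 it is a pair of
    signs.  In degree 2 the matrices in the basis [(v, v s1)] are those of
    rho_{2,k}, the eigenvalue being [exp (-2 i pi k / n)]; exchanging the two
    basis vectors replaces [k] by [n - k], which brings [k] into [0 .. n/2],
    and both ends are excluded because there the eigenvalue is a sign and the
    module splits.

    Kernels ([mem_rker_WI2]).  Each element of the group is [r^i] or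
    [r^i s1], and these 2n words are distinct.  The representation rho_{2,k}
    is nontrivial on every reflection and kills [r^i] exactly when
    [n | k i]; a sign representation is read off parities.

    Arithmetic.  Let [g] be the gcd of the numbers [gcd (n, k)] over the
    rho_{2,k} that occur.  All of them kill [r^i] exactly when [n | g i]; if
    rho_{1,3} or rho_{1,4} occurs, [i] must be even as well.  With [c = 1] or
    [c = 2] accordingly, the common kernel is trivial exactly when [n/c] and
    [g] are coprime ([faithful_WI2_sufficient], [faithful_WI2_necessary]).
    For [n = 2] there are only sign representations, and each of the three
    nontrivial elements has to be moved by one of them
    ([faithful_WI2_2]). *)

Set Implicit Arguments.
Unset Strict Implicit.
Unset Printing Implicit Defensive.

Import Order.TTheory GRing.Theory Num.Theory.
Local Open Scope ring_scope.

(** * Roots of unity in R[i] *)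

Section RootsOfUnity.

Variable R : realType.
Implicit Types x y : R.

Lemma expi0 : expi (0 : R) = 1.
Proof. by rewrite /expi cos0 sin0. Qed.

Lemma expiD x y : expi (x + y) = expi x * expi y.
Proof.
rewrite /expi cosD sinD; by congr (_ +i* _)%C; rewrite addrC.
Qed.

Lemma expi_neq0 x : expi x != 0.
Proof.
apply/negP => /eqP [cx0 sx0]; have /eqP := cos2Dsin2 x.
by rewrite cx0 sx0 expr0n addr0 eq_sym oner_eq0.
Qed.

Lemma expiN x : expi (- x) = (expi x)^-1.
Proof.
by apply: (mulfI (expi_neq0 x)); rewrite -expiD subrr expi0 divff ?expi_neq0.
Qed.

Lemma expiMn x k : expi (x *+ k) = expi x ^+ k.
Proof.
by elim: k => [|k IHk]; rewrite ?expi0 // mulrS expiD IHk exprS.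
Qed.

Lemma expi_2pi : expi (pi *+ 2 : R) = 1.
Proof. by rewrite /expi cos2pi sin2pi. Qed.

Definition zeta n : R[i] := expi (2 * pi / n%:R : R).

Lemma expi_zeta n k : expi (2 * pi * k%:R / n%:R : R) = zeta n ^+ k.
Proof. by rewrite -expiMn mulrAC mulr_natr. Qed.

Lemma zeta_neq0 n : zeta n != 0.
Proof. exact: expi_neq0. Qed.

Lemma zeta_expn n : (0 < n)%N -> zeta n ^+ n = 1.
Proof.
move=> n_gt0; rewrite -expi_zeta mulfK ?pnatr_eq0 -?lt0n //.
by rewrite mulr_natl expi_2pi.
Qed.

Lemma zeta_neq1 n k : (0 < k < n)%N -> zeta n ^+ k != 1.
Proof.
case/andP=> k_gt0 ltkn; have n_gt0 : (0 < n)%N by lia.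
(* For the half angle x, cos (2 x) = 1 would force sin x = 0. *)
pose x : R := pi * k%:R / n%:R; have sx_gt0 : 0 < sin x.
  apply: sin_gt0_pi; rewrite divr_gt0 ?mulr_gt0 ?pi_gt0 ?ltr0n //=.
  by rewrite ltr_pdivrMr ?ltr0n // ltr_pM2l ?pi_gt0 // ltr_nat.
rewrite -expi_zeta; apply/negP => /eqP[+ _].
have -> : 2 * pi * k%:R / n%:R = x *+ 2 by rewrite -[RHS]mulr_natl /x !mulrA.
rewrite cos_mulr2n => /eqP; rewrite -(cos2Dsin2 x) => /eqP.
have := exprn_gt0 2 sx_gt0; lra.
Qed.

Lemma zeta_prim n : (0 < n)%N -> n.-primitive_root (zeta n).
Proof.
move=> n_gt0; apply/andP; split=> //; apply/forallP=> i.
rewrite unity_rootE; have [->|ne] := eqVneq i.+1 n;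
  first by rewrite zeta_expn ?eqxx.
by apply/eqP/negbTE/zeta_neq1; have := ltn_ord i; lia.
Qed.

End RootsOfUnity.

(** * Constituents and kernels *)

Section Constituents.

Variables (F : fieldType) (gT : finGroupType) (G : {group gT}) (d : nat).
Variable rho : mx_representation F G d.

Lemma rker_occurs_in m (sigma : mx_representation F G m) :
  occurs_in sigma rho -> rker rho \subset rker sigma.
Proof.
case=> t [U [simU [_ _ [i /rker_mx_rsim <-]]]].
by rewrite rker_submod rstabS ?submx1.
Qed.

Lemma occurs_in_rsim m1 m2 (sigma : mx_representation F G m1)
    (tau : mx_representation F G m2) :
  mx_rsim sigma tau -> occurs_in sigma rho -> occurs_in tau rho.
Proof.
move=> sim [t [U [simU [defU dxU [i simi]]]]]; exists t, U, simU; split=> //.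
by exists i; apply: mx_rsim_trans simi sim.
Qed.

(** Simple submodules need not be computable over an arbitrary field, so complete
    reducibility yields a decomposition only under [classically]; [asbool] makes
    the conclusion a boolean, for which [classically] can be eliminated. *)
Lemma irr_decomposition : ([pchar F]^'.-group G)%g ->
  exists (t : nat) (U : 'I_t -> 'M[F]_d),
    [/\ forall i, mxsimple rho (U i), (\sum_i U i :=: 1%:M)%MS &
        mxdirect (\sum_i U i)%MS].
Proof.
move=> pcharG; apply/asboolP.
apply: (mx_reducible_semisimple (mxmodule1 rho) (mx_Maschke_pchar rho pcharG)).
case=> I U W simU defW dxW; apply/asboolP.
have enum_bij := onW_bij xpredT (@enum_val_bij I).
exists #|I|, (U \o enum_val); split=> [i||]; first exact: simU.
  by rewrite /W (reindex _ enum_bij) in defW.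
by move: dxW; rewrite /W !mxdirectE /= !(reindex _ enum_bij).
Qed.

(** Maschke's theorem splits [rho] into simple summands, each of which affords an
    irreducible representation that occurs in [rho]; an element acting trivially
    on every summand acts trivially on their sum. *)
Lemma mem_rker_constituents x : ([pchar F]^'.-group G)%g -> x \in G ->
    (forall m (sigma : mx_representation F G m),
       mx_irreducible sigma -> occurs_in sigma rho -> x \in rker sigma) ->
  x \in rker rho.
Proof.
move=> /irr_decomposition[t [U [simU defU dxU]]] Gx kerx.
rewrite /rker -(eqmx_rstab _ defU) inE Gx /=; apply/eqP.
have actU i : U i *m rho x = U i.
  have : x \in rker (submod_repr (mxsimple_module (simU i))).
    apply: kerx; first exact/submod_mx_irr.
    by exists t, U, simU; split=> //; exists i; apply: mx_rsim_refl.
  by rewrite rker_submod inE Gx => /eqP.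
have /sub_sumsmxP[B ->] : (\sum_i U i <= \sum_i U i)%MS by [].
by rewrite mulmx_suml; apply: eq_bigr => i _; rewrite -mulmxA actU.
Qed.

End Constituents.

(** * Words in the dihedral group *)

Section DihedralGroup.

Variables (gT : finGroupType) (G : {group gT}) (s1 s2 : gT) (n : nat).
Hypotheses (n_gt1 : (1 < n)%N) (dihG : is_WI2 G s1 s2 n).
Local Notation r := (s1 * s2)%g.

Lemma WI2_gens : s1 \in G /\ s2 \in G.
Proof. by case: dihG => _ -> _ _ _; rewrite !mem_gen ?set21 ?set22. Qed.

Lemma WI2_rot_in : r \in G.
Proof. by have [Gs1 Gs2] := WI2_gens; rewrite groupM. Qed.

(** [s1] conjugates the rotation to its inverse, hence normalises the cyclic group
    of rotations. *)
Lemma WI2_mulg : (G : {set gT}) = (<[r]> * <[s1]>)%g.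
Proof.
case: dihG => _ defG s1s1 s2s2 _; have [Gs1 Gs2] := WI2_gens.
have Vs1 : (s1^-1 = s1)%g by apply/eqP; rewrite eq_invg_mul -expg2 s1s1.
have Vs2 : (s2^-1 = s2)%g by apply/eqP; rewrite eq_invg_mul -expg2 s2s2.
have nrs1 : (<[s1]> \subset 'N(<[r]>))%g.
  rewrite cycle_subG inE -cycleJ cycle_subG.
  have -> : (r ^ s1 = r^-1)%g by rewrite conjgE -(mulgA s1) mulKg invMg Vs1 Vs2.
  by rewrite groupV cycle_id.
rewrite -(norm_joinEr nrs1); apply/eqP; rewrite eqEsubset join_subG !cycle_subG.
rewrite Gs1 groupM // !andbT defG gen_subG subUset !sub1set.
have s1H : s1 \in (<[r]> <*> <[s1]>)%g.
  by rewrite (subsetP (joing_subr _ _)) ?cycle_id.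
rewrite s1H -[X in X \in _](mulKg s1) groupM ?groupV //.
by rewrite (subsetP (joing_subl _ _)) ?cycle_id.
Qed.

Lemma WI2_mem x : x \in G -> exists i (j : bool), x = (r ^+ i * s1 ^+ j)%g.
Proof.
rewrite WI2_mulg => /mulsgP[_ _ /cycleP[i ->] /cycleP[j ->] ->].
have [_ _ s1s1 _ _] := dihG.
by exists i, (odd j); rewrite -modn2 expg_mod.
Qed.

(** The relations give upper bounds for the two orders. They are reached because
    the presentation makes [G] map onto the dihedral group of order [2 n]. *)
Lemma WI2_order : [/\ #[r]%g = n, #[s1]%g = 2%N & (<[r]> :&: <[s1]> = 1)%g].
Proof.
have [isoG _ s1s1 _ rn1] := dihG.
have rn : (#[r]%g %| n)%N by rewrite order_dvdn rn1.
have s1n : (#[s1]%g %| 2)%N by rewrite order_dvdn s1s1.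
have D_G : ('D_(n.*2)%G \homg G)%g.
  by rewrite isoG; apply: isoGrp_hom; apply: Grp'_dihedral.
have : (n.*2 <= #|G|)%N by rewrite -(card_dihedral n_gt1) leq_homg.
have := mul_cardG <[r]>%G <[s1]>%G; rewrite -WI2_mulg -!orderE => cardG leG.
have := dvdn_leq (ltnW n_gt1) rn; have := dvdn_leq (isT : 0 < 2)%N s1n.
have := cardG_gt0 (<[r]> :&: <[s1]>)%G => /= I_gt0 les1 ler.
have [-> -> I1] : [/\ #[r]%g = n, #[s1]%g = 2%N & #|(<[r]> :&: <[s1]>)%g| = 1%N].
  have up := leq_mul ler les1.
  have lo : (n * 2 * #|(<[r]> :&: <[s1]>)%g| <= #[r]%g * #[s1]%g)%N.
    by rewrite cardG muln2 leq_mul2r leG orbT.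
  move: I_gt0 les1 ler up lo; move: #|_| #[_]%g #[_]%g => I a b; split; nia.
by split=> //; apply/eqP; rewrite trivg_card1 I1.
Qed.

Lemma WI2_word_eq1 i (j : bool) :
  ((r ^+ i * s1 ^+ j)%g == 1%g) = (n %| i)%N && ~~ j.
Proof.
have [or os1 TI] := WI2_order; rewrite -or order_dvdn.
case: j; rewrite ?mulg1 ?andbT ?andbF //; apply/negP; rewrite expg1 => /eqP ris1.
have : s1 \in (<[r]> :&: <[s1]>)%g.
  by rewrite inE cycle_id andbT -[X in X \in _](mulg1_eq ris1) groupV mem_cycle.
by rewrite TI inE -order_eq1 os1.
Qed.

End DihedralGroup.

(** * Diagonal and antidiagonal 2 x 2 matrices *)

Section DihedralMatrices.

Variable F : fieldType.
Implicit Types a b c e : F.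

Definition diag2 a b : 'M[F]_2 :=
  \matrix_(i, j) (if i == j then if i == 0 then a else b else 0).

Lemma mul_antidiag2 a b c e :
  antidiag2 a b *m antidiag2 c e = diag2 (a * e) (b * c).
Proof.
apply/matrixP=> i j; rewrite !mxE big_ord_recl big_ord1 !mxE.
by case: (unliftP 0 i) => [i'|] ->; case: (unliftP 0 j) => [j'|] ->;
  rewrite ?ord1 /= ?mulr0 ?mul0r ?addr0 ?add0r.
Qed.

Lemma mul_diag2 a b c e : diag2 a b *m diag2 c e = diag2 (a * c) (b * e).
Proof.
apply/matrixP=> i j; rewrite !mxE big_ord_recl big_ord1 !mxE.
by case: (unliftP 0 i) => [i'|] ->; case: (unliftP 0 j) => [j'|] ->;
  rewrite ?ord1 /= ?mulr0 ?mul0r ?addr0 ?add0r.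
Qed.

Lemma mul_diag2_antidiag2 a b c e :
  diag2 a b *m antidiag2 c e = antidiag2 (a * c) (b * e).
Proof.
apply/matrixP=> i j; rewrite !mxE big_ord_recl big_ord1 !mxE.
by case: (unliftP 0 i) => [i'|] ->; case: (unliftP 0 j) => [j'|] ->;
  rewrite ?ord1 /= ?mulr0 ?mul0r ?addr0 ?add0r.
Qed.

Lemma diag2_eq1 a b : diag2 a b = 1%:M <-> a = 1 /\ b = 1.
Proof.
split=> [/matrixP eq1 | [-> ->]].
  by have := eq1 0 0; have := eq1 1 1; rewrite !mxE.
by apply/matrixP=> i j; rewrite !mxE if_same; case: (i == j).
Qed.

Lemma antidiag2_neq1 a b : antidiag2 a b != 1%:M.
Proof.
by apply/negP => /eqP/matrixP/(_ 0 0)/eqP; rewrite !mxE /= eq_sym oner_eq0.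
Qed.

Lemma diag2_exp a b k : diag2 a b ^+ k = diag2 (a ^+ k) (b ^+ k).
Proof.
elim: k => [|k IHk]; first by symmetry; apply/diag2_eq1.
by rewrite !exprS IHk -mul_diag2.
Qed.

End DihedralMatrices.

(** * Modules spanned by an eigenvector of the rotation and its mirror image *)

Section DihedralEigenvectors.

Variables (F : fieldType) (gT : finGroupType) (G : {group gT}) (s1 s2 : gT).
Hypothesis defG : G :=: <<[set s1; s2]>>%g.
Variables (m : nat) (sigma : mx_representation F G m).

Lemma mxmodule_gen2 k (U : 'M_(k, m)) :
  (U *m sigma s1 <= U)%MS -> (U *m sigma s2 <= U)%MS -> mxmodule sigma U.
Proof.
move=> Us1 Us2; rewrite /mxmodule {1}defG gen_subG subUset !sub1set !inE.
by rewrite Us1 Us2 defG !mem_gen ?set21 ?set22.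
Qed.

Lemma rank_irr_gen2 k (U : 'M_(k, m)) :
    mx_irreducible sigma -> U != 0 ->
    (U *m sigma s1 <= U)%MS -> (U *m sigma s2 <= U)%MS ->
  \rank U = m.
Proof.
move=> /mx_irrP[_ irr] nzU Us1 Us2.
have := irr <<U>>%MS; rewrite (eqmx_module _ (genmxE U)) mxmodule_gen2 //.
rewrite -mxrank_eq0 genmxE mxrank_eq0 nzU => /(_ isT isT).
by rewrite /row_full genmxE => /eqP.
Qed.

Lemma irr_common_eigenvector (u : 'rV_m) a b :
    mx_irreducible sigma -> u != 0 ->
    u *m sigma s1 = a *: u -> u *m sigma s2 = b *: u ->
  m = 1%N.
Proof.
move=> irr nzu us1 us2; rewrite -(rank_irr_gen2 irr nzu) ?us1 ?us2 ?scalemx_sub //.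
by apply/eqP; rewrite rank_rV nzu.
Qed.

Definition mirror_mx (v : 'rV[F]_m) : 'M_(2, m) :=
  \matrix_(i < 2) (if i == 0 then v else v *m sigma s1).

Variables (v : 'rV[F]_m) (z : F).
Hypotheses (s1s1 : (s1 ^+ 2 = 1)%g) (s2s2 : (s2 ^+ 2 = 1)%g).
Hypotheses (nzv : v != 0) (vr : v *m sigma (s1 * s2)%g = z^-1 *: v).
Hypothesis nzz : z != 0.

Let Gs1 : s1 \in G. Proof. by rewrite defG mem_gen ?set21. Qed.
Let Gs2 : s2 \in G. Proof. by rewrite defG mem_gen ?set22. Qed.
Let mulms1 : sigma s1 *m sigma s1 = 1%:M.
Proof. by rewrite -repr_mxM // -expg2 s1s1 repr_mx1. Qed.
Let mulms2 : sigma s2 *m sigma s2 = 1%:M.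
Proof. by rewrite -repr_mxM // -expg2 s2s2 repr_mx1. Qed.

Lemma rot_eigen_s2 : v *m sigma s2 = z *: (v *m sigma s1).
Proof.
have := congr1 (fun w => z *: (w *m sigma s2)) vr.
rewrite -scalemxAl scalerA divff // scale1r => <-.
by rewrite repr_mxM // !mulmxA -(mulmxA _ (sigma s2)) mulms2 mulmx1.
Qed.

Lemma rot_eigen_swap : v *m sigma s1 *m sigma (s1 * s2)%g = z *: (v *m sigma s1).
Proof.
by rewrite repr_mxM // !mulmxA -(mulmxA v) mulms1 mulmx1 rot_eigen_s2.
Qed.

Lemma rot_eigen_swap_s2 : v *m sigma s1 *m sigma s2 = z^-1 *: v.
Proof. by rewrite -vr repr_mxM // mulmxA. Qed.

Lemma antidiag2_mul_rows a b (w1 w2 : 'rV[F]_m) :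
  antidiag2 a b *m (\matrix_(i < 2) if i == 0 then w1 else w2) =
    \matrix_(i < 2) if i == 0 then a *: w2 else b *: w1.
Proof.
apply/matrixP=> i j; rewrite !mxE big_ord_recl big_ord1 !mxE.
by case: (unliftP 0 i) => [i'|] ->;
  rewrite ?ord1 /= !mxE ?mulr0 ?mul0r ?addr0 ?add0r.
Qed.

Lemma mirror_mx_s1 : mirror_mx v *m sigma s1 = antidiag2 1 1 *m mirror_mx v.
Proof.
rewrite antidiag2_mul_rows; apply/row_matrixP=> i; rewrite row_mul !rowK.
by case: eqP => _; rewrite scale1r // -mulmxA mulms1 mulmx1.
Qed.

Lemma mirror_mx_s2 : mirror_mx v *m sigma s2 = antidiag2 z z^-1 *m mirror_mx v.
Proof.
rewrite antidiag2_mul_rows; apply/row_matrixP=> i; rewrite row_mul !rowK.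
by case: eqP => _; rewrite ?rot_eigen_s2 ?rot_eigen_swap_s2.
Qed.

Lemma rank_mirror_mx : mx_irreducible sigma -> \rank (mirror_mx v) = m.
Proof.
move=> irr; apply: rank_irr_gen2 => //.
- by apply: contraNneq nzv => /(congr1 (row 0)); rewrite rowK row0 /= => ->.
- by rewrite mirror_mx_s1 submxMl.
- by rewrite mirror_mx_s2 submxMl.
Qed.

Lemma irr_degree_le2 : mx_irreducible sigma -> (m <= 2)%N.
Proof. by move/rank_mirror_mx => <-; apply: rank_leq_row. Qed.

(** If the eigenvalue of the rotation is a sign, then [v + v s1] is an eigenvector
    of both generators, or it vanishes and [v] itself is one; the degree is then 1. *)
Lemma rot_eigen_neq_sign (e : bool) : mx_irreducible sigma -> m = 2%N ->
  z != (-1) ^+ e.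
Proof.
move=> irr m2; apply/eqP => ze.
have Vz : z^-1 = z by rewrite ze; case: (e); rewrite ?invr1 ?invrN1.
pose u := v + v *m sigma s1.
have [u0 | nzu] := eqVneq u 0.
  have vs1 : v *m sigma s1 = - v by apply/eqP; rewrite -addr_eq0 addrC -/u u0.
  have := @irr_common_eigenvector v (-1) (- z) irr nzv.
  by rewrite rot_eigen_s2 vs1 scaleN1r scalerN scaleNr => /(_ erefl erefl); rewrite m2.
have := @irr_common_eigenvector u 1 z irr nzu.
rewrite !mulmxDl -mulmxA mulms1 mulmx1 rot_eigen_swap_s2 rot_eigen_s2 Vz.
by rewrite -scalerDr scale1r addrC => /(_ erefl erefl); rewrite m2.
Qed.

End DihedralEigenvectors.

(** Change of basis to an eigenvector of the rotation followed by its mirror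
    image. *)
Lemma antidiag2_rsim (F : fieldType) (gT : finGroupType) (G : {group gT})
    (s1 s2 : gT) (defG : G :=: <<[set s1; s2]>>%g)
    (sigma : mx_representation F G 2) (v : 'rV[F]_2) (z : F) :
    (s1 ^+ 2 = 1)%g -> (s2 ^+ 2 = 1)%g -> v != 0 -> z != 0 ->
    v *m sigma (s1 * s2)%g = z^-1 *: v -> mx_irreducible sigma ->
  exists tau : mx_representation F G 2,
    [/\ tau s1 = antidiag2 1 1, tau s2 = antidiag2 z z^-1 & mx_rsim sigma tau].
Proof.
move=> s1s1 s2s2 nzv nzz vr irr; pose B := mirror_mx s1 sigma v.
have uB : B \in unitmx.
  by rewrite -row_free_unit /row_free (rank_mirror_mx defG s1s1 s2s2 nzv vr).
exists (rconj_repr sigma uB); split.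
- by rewrite rconj_mxE (mirror_mx_s1 defG) // mulmxK.
- by rewrite rconj_mxE (mirror_mx_s2 defG s2s2 vr) // mulmxK.
apply: mx_rsim_sym; exists B => // [|x Gx]; first by rewrite row_free_unit.
by rewrite rconj_mxE mulmxKV.
Qed.

(** * Irreducible representations of the dihedral group *)

Section Classification.

Variables (R : realType) (gT : finGroupType) (G : {group gT}) (s1 s2 : gT).
Variable n : nat.
Hypotheses (n_gt1 : (1 < n)%N) (dihG : is_WI2 G s1 s2 n).
Local Notation r := (s1 * s2)%g.
Local Notation zn := (zeta R n).

(** Exchanging an eigenvector with its mirror image inverts the eigenvalue, so the
    exponent of the root of unity can be taken between [0] and [n/2]. The
    eigenvalue is written as an inverse because [zn ^+ k] then lands in the upper
    right corner of the matrix of [s2], as in rho_{2,k}. *)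
Lemma rot_eigenvector m (sigma : mx_representation R[i] G m) : (0 < m)%N ->
  exists (k : nat) (v : 'rV_m),
    [/\ (k.*2 <= n)%N, v != 0 & v *m sigma r = (zn ^+ k)^-1 *: v].
Proof.
move=> m_gt0; have [_ defG s1s1 s2s2 rn1] := dihG.
have n_gt0 : (0 < n)%N by lia.
have [Gs1 Gs2] := WI2_gens dihG; have Gr := WI2_rot_in dihG.
have [a /eigenvalueP[v vr nzv]] := eigenvalue_closed (sigma r) m_gt0.
have an1 : a ^+ n = 1.
  have vrk k : v *m sigma (r ^+ k)%g = a ^+ k *: v.
    elim: k => [|k IHk]; first by rewrite repr_mx1 mulmx1 scale1r.
    rewrite expgSr repr_mxM ?groupX // mulmxA IHk -scalemxAl vr.
    by rewrite scalerA exprSr.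
  have /eqP := vrk n; rewrite rn1 repr_mx1 mulmx1 -subr_eq0.
  rewrite -[X in X - _]scale1r -scalerBl scaler_eq0 (negPf nzv) orbF subr_eq0.
  by move/eqP.
have [i def_a] := prim_rootP (zeta_prim R n_gt0) an1.
have nzi : zn ^+ i != 0 by rewrite expf_neq0 ?zeta_neq0.
have [le_i|gt_i] := leqP i.*2 n.
  (* The eigenvalue zn ^+ i lacks the inverse: the mirror image has it. *)
  exists i, (v *m sigma s1); split=> //.
    apply: contraNneq nzv => /(congr1 (mulmx^~ (sigma s1))).
    by rewrite -mulmxA -repr_mxM // -expg2 s1s1 repr_mx1 mulmx1 mul0mx => ->.
  apply: (rot_eigen_swap defG s1s1 s2s2); last by rewrite invr_eq0.
  by rewrite invrK vr def_a.
exists (n - i)%N, v; split=> //; first by have := ltn_ord i; lia.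
rewrite vr def_a; congr (_ *: _); apply: (mulfI (x := zn ^+ (n - i))).
  by rewrite expf_neq0 ?zeta_neq0.
by rewrite mulfV ?expf_neq0 ?zeta_neq0 // -exprD subnK ?zeta_expn // ltnW.
Qed.

(** The signs [a] and [b] cover the four one-dimensional representations; for odd
    [n] the two with [a != b] are excluded by [has_sign_oddn]. *)
Lemma irr_WI2 m (sigma : mx_representation R[i] G m) : mx_irreducible sigma ->
  (exists (a b : bool) (tau : mx_representation R[i] G 1),
     [/\ tau s1 = ((-1) ^+ a)%:M, tau s2 = ((-1) ^+ b)%:M & mx_rsim sigma tau])
  \/ (exists (k : nat) (tau : mx_representation R[i] G 2),
     [/\ rho2_range n k, tau s1 = antidiag2 1 1,
         tau s2 = antidiag2 (zn ^+ k) (zn ^+ k)^-1 & mx_rsim sigma tau]).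
Proof.
move=> irr; have [m_gt0 _] := (mx_irrP sigma).1 irr.
have [_ defG s1s1 s2s2 rn1] := dihG; have [Gs1 Gs2] := WI2_gens dihG.
have [k [v [le_k nzv vr]]] := rot_eigenvector sigma m_gt0.
have nzz : zn ^+ k != 0 by rewrite expf_neq0 ?zeta_neq0.
have [m1 | m2] : 1%N = m \/ 2%N = m.
  by have := irr_degree_le2 defG s1s1 s2s2 nzv vr nzz irr; lia.
- left; case: _ / m1 in sigma irr {v vr nzv} *.
  have sign x : x \in G -> (x ^+ 2 = 1)%g ->
      exists e : bool, sigma x = ((-1) ^+ e)%:M.
    move=> Gx xx; have := repr_mxM sigma Gx Gx; rewrite -expg2 xx repr_mx1.
    rewrite [sigma x]mx11_scalar -scalar_mxM => /(congr1 (fun A : 'M_1 => A 0 0)).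
    rewrite !mxE /= !mulr1n -expr2 => /esym/eqP.
    by rewrite sqrf_eq1 => /orP[] /eqP ->; [exists false | exists true].
  have [a s1a] := sign _ Gs1 s1s1; have [b s2b] := sign _ Gs2 s2s2.
  by exists a, b, sigma; split=> //; apply: mx_rsim_refl.
right; case: _ / m2 in sigma irr v vr nzv *.
have [tau [tau1 tau2 sim]] := antidiag2_rsim defG s1s1 s2s2 nzv nzz vr irr.
exists k, tau; split=> //.
(* k = 0 and k = n/2 would make the eigenvalue of the rotation 1 or -1. *)
have nosign (e : bool) : zn ^+ k != (-1) ^+ e.
  exact: (rot_eigen_neq_sign defG s1s1 s2s2 nzv vr nzz e irr erefl).
have k_gt0 : (0 < k)%N.
  by rewrite lt0n; apply: contraNneq (nosign false) => ->; rewrite expr0.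
suff k_ltn : (k.*2 < n)%N by rewrite /rho2_range k_gt0 /=; case: ifP; lia.
rewrite ltn_neqAle le_k andbT; apply: contraNneq (nosign true) => def_n.
have /eqP : (zn ^+ k) ^+ 2 = 1 by rewrite -exprM muln2 def_n zeta_expn // ltnW.
rewrite sqrf_eq1 => /orP[/eqP zk1 | //].
have /negP[] : zn ^+ k != 1 by apply: zeta_neq1; rewrite k_gt0 /=; lia.
by rewrite zk1.
Qed.

End Classification.

(** * Kernels of representations of the dihedral group *)

Section Kernel.

Variables (R : realType) (gT : finGroupType) (G : {group gT}) (s1 s2 : gT).
Variable n : nat.
Hypotheses (n_gt1 : (1 < n)%N) (dihG : is_WI2 G s1 s2 n).
Variables (d : nat) (rho : mx_representation R[i] G d).
Local Notation r := (s1 * s2)%g.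
Local Notation zn := (zeta R n).

(** One predicate for all one-dimensional representations: [true] stands for the
    sign -1, so rho_{1,2}, rho_{1,3} and rho_{1,4} are the pairs (true, true),
    (false, true) and (true, false). *)
Definition has_sign (a b : bool) : Prop :=
  has_irr s1 s2 rho (((-1) ^+ a)%:M : 'M[R[i]]_1) ((-1) ^+ b)%:M.

(** The exponent of [-1] by which a sign representation acts on the word
    [r^i s1^j]. *)
Lemma odd_word (a b j : bool) (i : nat) :
  odd ((a + b) * i + a * j) = ((a (+) b) && odd i) (+) (a && j).
Proof. by rewrite oddD (oddM (a + b)) (oddM a) (oddD a b) !oddb. Qed.

Lemma scalar_mx11_eq1 (z : R[i]) : ((z%:M : 'M_1) == 1%:M) = (z == 1).
Proof.
by apply/eqP/eqP => [/(congr1 (fun A : 'M_1 => A 0 0)) | -> //]; rewrite !mxE.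
Qed.

Lemma has_rho2E k : has_rho2 s1 s2 n rho k =
  has_irr s1 s2 rho (antidiag2 1 1) (antidiag2 (zn ^+ k) (zn ^+ k)^-1).
Proof. by rewrite /has_rho2 expiN expi_zeta. Qed.

Lemma WI2_word_in i (j : bool) : (r ^+ i * s1 ^+ j)%g \in G.
Proof. by have [Gs1 Gs2] := WI2_gens dihG; rewrite groupM ?groupX ?groupM. Qed.

Lemma rker_sign (tau : mx_representation R[i] G 1) (a b : bool) i (j : bool) :
    tau s1 = ((-1) ^+ a)%:M -> tau s2 = ((-1) ^+ b)%:M ->
  ((r ^+ i * s1 ^+ j)%g \in rker tau) = ~~ (((a (+) b) && odd i) (+) (a && j)).
Proof.
move=> tau1 tau2; have [Gs1 Gs2] := WI2_gens dihG.
rewrite inE WI2_word_in mul1mx repr_mxM ?groupX ?groupM // !repr_mxX ?groupM //.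
rewrite repr_mxM // tau1 tau2 -scalar_mxM -!rmorphXn /= -scalar_mxM.
rewrite -exprD -exprM -exprM -exprD -signr_odd scalar_mx11_eq1.
rewrite odd_word.
case: (_ (+) _); rewrite ?eqxx //; apply/negbTE.
by rewrite expr1 -subr_eq0 -opprD oppr_eq0 -mulr2n pnatr_eq0.
Qed.

Lemma rker_rho2 (tau : mx_representation R[i] G 2) k i (j : bool) :
    tau s1 = antidiag2 1 1 -> tau s2 = antidiag2 (zn ^+ k) (zn ^+ k)^-1 ->
  ((r ^+ i * s1 ^+ j)%g \in rker tau) = ~~ j && (n %| k * i)%N.
Proof.
move=> tau1 tau2; have [Gs1 Gs2] := WI2_gens dihG.
rewrite inE WI2_word_in mul1mx repr_mxM ?groupX ?groupM // !repr_mxX ?groupM //.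
rewrite repr_mxM // tau1 tau2 mul_antidiag2 !mul1r diag2_exp.
case: j; first by rewrite expr1 mul_diag2_antidiag2; apply/negbTE/antidiag2_neq1.
rewrite expr0 mulmx1 (prim_order_dvd (zeta_prim R (ltnW n_gt1))) exprM.
rewrite exprVn; apply/eqP/eqP => [/diag2_eq1[]|->] //.
by apply/diag2_eq1; rewrite invr1.
Qed.

(** Membership in the kernel of [rho] becomes a condition on parities and
    divisibility, which is the form used for both directions of the theorem. *)
Lemma mem_rker_WI2 i (j : bool) :
  (r ^+ i * s1 ^+ j)%g \in rker rho <->
  (forall a b, has_sign a b -> ~~ (((a (+) b) && odd i) (+) (a && j))) /\
  (forall k, rho2_range n k -> has_rho2 s1 s2 n rho k ->
     ~~ j && (n %| k * i)%N).
Proof.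
split=> [kerx | [ker1 ker2]].
  split=> [a b [tau [t1 t2 occ]] | k _].
    by rewrite -(rker_sign _ _ t1 t2) (subsetP (rker_occurs_in occ)).
  rewrite has_rho2E => -[tau [t1 t2 occ]].
  by rewrite -(rker_rho2 _ _ t1 t2) (subsetP (rker_occurs_in occ)).
apply: mem_rker_constituents (WI2_word_in _ _) _ => [|m sigma irr occ].
  by rewrite /pgroup pcharf'_nat pnatr_eq0 -lt0n cardG_gt0.
have [[a [b [tau [t1 t2 sim]]]] | [k [tau [kr t1 t2 sim]]]] := irr_WI2 n_gt1 dihG irr.
  rewrite (rker_mx_rsim sim) (rker_sign _ _ t1 t2) ker1 //.
  by exists tau; split=> //; apply: occurs_in_rsim sim occ.
rewrite (rker_mx_rsim sim) (rker_rho2 _ _ t1 t2) ker2 // has_rho2E.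
by exists tau; split=> //; apply: occurs_in_rsim sim occ.
Qed.

Lemma faithful_WI2P : mx_faithful rho <->
  (forall i (j : bool), (r ^+ i * s1 ^+ j)%g \in rker rho -> (n %| i)%N && ~~ j).
Proof.
split=> [/subsetP faith i j /faith | faith].
  by rewrite inE (WI2_word_eq1 n_gt1 dihG).
apply/subsetP=> x kerx; have Gx := subsetP (rstab_sub _ _) _ kerx.
have [i [j def_x]] := WI2_mem dihG Gx.
by rewrite def_x inE (WI2_word_eq1 n_gt1 dihG) faith // -def_x.
Qed.

End Kernel.

(** * Gcd arithmetic *)

Section GcdArithmetic.

Variable n : nat.
Implicit Types (j k : nat) (ks : seq nat).

Lemma dvdn_mul_gcd_gcds ks j :
  {in ks, forall k, n %| k * j}%N -> (n %| j * gcd_gcds n ks)%N.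
Proof.
rewrite /gcd_gcds; elim: ks => [|k ks IHks] dvdks; first by rewrite big_nil muln0.
rewrite big_cons muln_gcdr dvdn_gcd IHks => [|k' k'ks]; last first.
  by apply: dvdks; rewrite inE k'ks orbT.
by rewrite muln_gcdr dvdn_gcd dvdn_mull // mulnC dvdks ?mem_head.
Qed.

Lemma gcd_gcds_dvdn ks k : k \in ks -> (gcd_gcds n ks %| gcdn n k)%N.
Proof.
rewrite /gcd_gcds; elim: ks => // k' ks IHks; rewrite inE big_cons.
case/predU1P=> [-> | /IHks]; first exact: dvdn_gcdl.
exact: dvdn_trans (dvdn_gcdr _ _).
Qed.

Lemma gcdn_gcd_gcds ks : ks != [::] -> gcdn n (gcd_gcds n ks) = gcd_gcds n ks.
Proof.
case: ks => // k ks _; apply/gcdn_idPr.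
by apply: dvdn_trans (gcd_gcds_dvdn (mem_head k ks)) (dvdn_gcdl _ _).
Qed.

End GcdArithmetic.

(** * Faithful representations *)

Section Faithful.

Variables (R : realType) (gT : finGroupType) (G : {group gT}) (s1 s2 : gT).
Variable n : nat.
Hypotheses (n_gt1 : (1 < n)%N) (dihG : is_WI2 G s1 s2 n).
Variables (d : nat) (rho : mx_representation R[i] G d).
Local Notation r := (s1 * s2)%g.
Local Notation has_sign := (has_sign s1 s2 rho).
Local Notation has_rho2 := (has_rho2 s1 s2 n rho).
Let kerP := mem_rker_WI2 n_gt1 dihG rho.
Let faithP := faithful_WI2P n_gt1 dihG rho.

(** Since [r^n = 1], the product of the two signs has an odd power equal to 1. *)
Lemma has_sign_oddn a b : odd n -> has_sign a b -> a = b.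
Proof.
move=> oddn hab; have /kerP[+ _] : (r ^+ n * s1 ^+ false)%g \in rker rho.
  have /eqP -> : (r ^+ n * s1 ^+ false)%g == 1%g.
    by rewrite (WI2_word_eq1 n_gt1 dihG) dvdnn.
  exact: group1.
by move=> /(_ _ _ hab); case: a b {hab} => [] []; rewrite ?oddn.
Qed.

(** The set of all [k] for which rho_{2,k} occurs is the best choice of indices:
    the gcd is the smallest for it. *)
Lemma has_rho2_seq : exists ks : seq nat,
  uniq ks /\ forall k, (k \in ks) <-> rho2_range n k /\ has_rho2 k.
Proof.
exists [seq k <- iota 0 n | rho2_range n k && `[< has_rho2 k >]].
split=> [|k]; first by rewrite filter_uniq ?iota_uniq.
rewrite mem_filter mem_iota add0n /=; split=> [|[kr hk]].
  by case/andP=> /andP[-> /asboolP].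
rewrite kr asboolT //=; move: kr; rewrite /rho2_range.
by case: ifP; lia.
Qed.

(** The nontrivial elements are [s1 s2], [s1] and [r s1 = s2]. Each of them is
    detected by exactly two of rho_{1,2}, rho_{1,3}, rho_{1,4}, so any two of
    these detect all, while one alone misses an element. *)
Lemma faithful_WI2_2 : n = 2%N -> mx_faithful rho <-> faithful_cond_2 s1 s2 rho.
Proof.
move=> n2; have no_rho2 k : rho2_range n k = false.
  by rewrite /rho2_range n2; case: k.
have has_rho12E : has_rho12 s1 s2 rho = has_sign true true by [].
have has_rho13E : has_rho13 s1 s2 rho = has_sign false true by [].
have has_rho14E : has_rho14 s1 s2 rho = has_sign true false by [].
rewrite faithP /faithful_cond_2 has_rho12E has_rho13E has_rho14E.
split=> [faith | two i j /kerP[ker1 _]].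
  have nontriv i (j : bool) : ~~ ((n %| i)%N && ~~ j) ->
      exists a b, has_sign a b /\ (((a (+) b) && odd i) (+) (a && j)).
    move=> /negP nij; apply: contrapT => none; apply/nij/faith/kerP.
    split=> [a b hab | k]; last by rewrite no_rho2.
    by apply/negP => oddab; apply: none; exists a, b.
  have [|a1 [b1 [h1 o1]]] := nontriv 1%N true; first by rewrite andbF.
  have [|a2 [b2 [h2 o2]]] := nontriv 1%N false; first by rewrite n2.
  have [|a3 [b3 [h3 o3]]] := nontriv 0%N true; first by rewrite andbF.
  case: a1 b1 h1 o1 => [] [] // h1 _; case: a2 b2 h2 o2 => [] [] // h2 _;
  case: a3 b3 h3 o3 => [] [] // h3 _;
  by [apply: Or31 | apply: Or32 | apply: Or33].
rewrite n2 dvdn2; move: two ker1.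
by case=> -[h1 h2] ker1; have := ker1 _ _ h1; have := ker1 _ _ h2;
  rewrite /=; case: (odd i); case: (j).
Qed.

Lemma has_rho2s_of_seq ks : ks != [::] ->
  (forall k, (k \in ks) -> rho2_range n k /\ has_rho2 k) ->
  has_rho2s s1 s2 n rho ks.
Proof. by case: ks. Qed.

(** A word in the kernel is a rotation [r^i], since some rho_{2,k} occurs, and
    [n | g i] for [g] the gcd. If [c = 2], a sign representation that is -1 on
    the rotation makes [i] even, and dividing by [c] shows that coprimality of
    [n/c] with [g] is enough for [n | i]. *)
Lemma faithful_WI2_sufficient ks (c : nat) : has_rho2s s1 s2 n rho ks ->
    (c = 1%N \/ (c = 2%N /\ exists a, has_sign a (~~ a))) -> (c %| n)%N ->
    gcdn (n %/ c) (gcd_gcds n ks) = 1%N ->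
  mx_faithful rho.
Proof.
case=> ks_gt0 ks_rho2 c_sign c_n gcd1.
apply/faithP => i j /kerP[ker1 ker2].
have kerk k : k \in ks -> ~~ j && (n %| k * i)%N.
  by case/ks_rho2; apply: ker2.
have {ks_gt0} j0 : ~~ j.
  by case: ks kerk ks_gt0 {ks_rho2 gcd1} => // k ks /(_ k (mem_head _ _))/andP[].
rewrite j0 andbT; have c_i : (c %| i)%N.
  case: c_sign => [-> | [-> [a ha]]]; first exact: dvd1n.
  by have := ker1 _ _ ha; rewrite (negPf j0) andbF addbF addbN addbb dvdn2.
have n_ig : (n %| i * gcd_gcds n ks)%N.
  by apply: dvdn_mul_gcd_gcds => k /kerk/andP[].
have c_gt0 : (0 < c)%N by rewrite (dvdn_gt0 (ltnW n_gt1)).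
rewrite -(divnK c_n) -(divnK c_i) dvdn_pmul2r //.
rewrite -[X in (_ %| X)%N]muln1 -gcd1 muln_gcdr dvdn_gcd dvdn_mull //=.
by rewrite -(dvdn_pmul2r c_gt0) divnK // mulnAC divnK.
Qed.

(** Let [g] be the gcd for all the rho_{2,k} that occur, and [h] the gcd of [n/c]
    and [g]. The rotation [r^i] with [i = c ((n/c) / h)] is killed by all these
    rho_{2,k}, and by the sign representations because [i] is even
    whenever one that is -1 on the rotation occurs. Faithfulness then forces
    [h = 1]. As [n > 2], coprimality fails for
    the empty list of indices, where the gcd is 0. *)
Lemma faithful_WI2_necessary (c : nat) : (2 < n)%N -> mx_faithful rho ->
    (c = 1%N /\ forall a, ~ has_sign a (~~ a)) \/ c = 2%N -> (c %| n)%N ->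
  exists ks, [/\ uniq ks, has_rho2s s1 s2 n rho ks &
                 gcdn (n %/ c) (gcd_gcds n ks) = 1%N].
Proof.
move=> n_gt2 /faithP faith c_sign c_n; have [ks [uks ksP]] := has_rho2_seq.
set g := gcd_gcds n ks; have c_gt0 : (0 < c)%N by case: c_sign => [[->]|->].
have nc_gt0 : (0 < n %/ c)%N by rewrite divn_gt0 // (dvdn_leq (ltnW n_gt1)).
have gcd1 : gcdn (n %/ c) g = 1%N.
  have gcd_gt0 : (0 < gcdn (n %/ c) g)%N by rewrite gcdn_gt0 nc_gt0.
  set q := ((n %/ c) %/ gcdn (n %/ c) g)%N.
  have q_gcd : (q * gcdn (n %/ c) g = n %/ c)%N by rewrite divnK ?dvdn_gcdl.
  have /andP[n_i _] : (n %| q * c)%N && ~~ false.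
    apply: faith; apply/kerP; split=> [a b hab | k kr hk].
      rewrite andbF addbF; case: c_sign => [[_ nosign] | ->].
        have -> : a = b.
          case: (eqVneq a b) => // neq_ab; case: (nosign a).
          by case: a b neq_ab hab => [] [].
        by rewrite addbb.
      by rewrite oddM !andbF.
    rewrite -(divnK c_n) mulnA dvdn_pmul2r // -q_gcd mulnC dvdn_mul //.
    have /gcd_gcds_dvdn : k \in ks by apply/ksP.
    move=> /(_ n); rewrite -/g dvdn_gcd => /andP[_ g_k].
    exact: dvdn_trans (dvdn_gcdr _ _) g_k.
  have q_gt0 : (0 < q)%N by rewrite divn_gt0 // (dvdn_leq nc_gt0) ?dvdn_gcdl.
  have : (q * gcdn (n %/ c) g %| q * 1)%N.
    by rewrite q_gcd muln1 -(dvdn_pmul2r c_gt0) divnK.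
  by rewrite dvdn_pmul2l // dvdn1 => /eqP.
exists ks; split=> //; apply: has_rho2s_of_seq => [|k /ksP //].
apply: contra_eqN gcd1 => /eqP ks0; rewrite /g ks0 /gcd_gcds big_nil gcdn0.
by case: c_sign => [[-> _]|->] in c_n *; rewrite ?divn1; lia.
Qed.

End Faithful.

Theorem theorem4p3 (R : realType) (gT : finGroupType) (G : {group gT})
    (s1 s2 : gT) (n : nat) (hn : (2 <= n)%N) (hG : is_WI2 G s1 s2 n)
    (d : nat) (rho : mx_representation R[i] G d) :
  mx_faithful rho <->
  [/\ n = 2%N -> faithful_cond_2 s1 s2 rho,
      (2 < n)%N -> ~~ (2 %| n)%N -> faithful_cond_odd s1 s2 n rho
    & (2 < n)%N -> (2 %| n)%N -> faithful_cond_even s1 s2 n rho].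
Proof.
have has_rho13E : has_rho13 s1 s2 rho = has_sign s1 s2 rho false true by [].
have has_rho14E : has_rho14 s1 s2 rho = has_sign s1 s2 rho true false by [].
have sufficient := faithful_WI2_sufficient hn hG (rho := rho).
have necessary := faithful_WI2_necessary hn hG (rho := rho).
rewrite /faithful_cond_odd /faithful_cond_even has_rho13E has_rho14E.
split=> [faith | [cond_2 cond_odd cond_even]].
  split=> [n2 | n_gt2 odd_n | n_gt2 even_n].
  - exact/(faithful_WI2_2 hn hG _ n2).
  - have [|ks [uks ks_rho2]] := necessary 1%N n_gt2 faith _ (dvd1n n).
      left; split=> // a; rewrite dvdn2 negbK in odd_n.
      by move/(has_sign_oddn hn hG odd_n); case: (a).
    rewrite divn1 => gcd1; exists ks; split=> //.
    by rewrite gcdn_gcd_gcds // in gcd1; case: ks_rho2; case: (ks).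
  have [[a ha] | no_sign] := pselect (exists a, has_sign s1 s2 rho a (~~ a)).
    right; split; first by case: a ha; [right | left].
    have [|ks [_ ks_rho2 gcd1]] := necessary 2%N n_gt2 faith _ even_n; first by right.
    by exists ks.
  left; split=> [h13 | h14 |].
  - by case: no_sign; exists false.
  - by case: no_sign; exists true.
  have [|ks [_ ks_rho2]] := necessary 1%N n_gt2 faith _ (dvd1n n).
    by left; split=> // a ha; apply: no_sign; exists a.
  rewrite divn1 => gcd1; exists ks; split=> //.
  by rewrite gcdn_gcd_gcds // in gcd1; case: ks_rho2; case: (ks).
have [n2 | n_gt2] : n = 2%N \/ (2 < n)%N by lia.
  by apply/(faithful_WI2_2 hn hG _ n2)/cond_2.
have [even_n | odd_n] := boolP (2 %| n)%N; last first.
  have [ks [_ ks_rho2 gcd1]] := cond_odd n_gt2 odd_n.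
  apply: (sufficient ks 1%N ks_rho2 _ (dvd1n n)); first by left.
  by rewrite gcd1 gcdn1.
have [[_ _ [ks [ks_rho2 gcd1]]] | [h1314 [ks [ks_rho2 gcd1]]]] := cond_even n_gt2 even_n.
  apply: (sufficient ks 1%N ks_rho2 _ (dvd1n n)); first by left.
  by rewrite gcd1 gcdn1.
apply: (sufficient ks 2%N ks_rho2) gcd1 => //; right; split=> //.
by case: h1314; [exists false | exists true].
Qed.
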